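(* Let $G_1,G_2\subset\mathbf{C}$ be convex domains with $G_1\neq\mathbf{C}$ and $G_2\neq\mathbf{C}$. Then for every complete Reinhardt domain $\mathcal{D}\subset\mathbf{C}^n$, $$R_1(\mathcal{D},G_1)=R_1(\mathcal{D},G_2),$$ and for every bounded complete Reinhardt domain $\mathcal{D}\subset\mathbf{C}^n$, $$R_2(\mathcal{D},G_1)=R_2(\mathcal{D},G_2).$$ That is, the first and second Bohr radii $R_1(\mathcal{D},G)$ and $R_2(\mathcal{D},G)$ are independent of the choice of the convex domain $G\neq\mathbf{C}$.
   Context: A domain is a nonempty connected open set. $n\geq1$. A complete Reinhardt domain $\mathcal{D}\subset\mathbf{C}^n$ is a domain such that $z\in\mathcal{D}$ and $|w_j|\leq|z_j|$ for $j=1,\dots,n$ imply $w\in\mathcal{D}$. A holomorphic function on such a $\mathcal{D}$ is the sum of its power series $f(z)=\sum_{|\alpha|\geq0}c_\alpha z^\alpha$, $z\in\mathcal{D}$, where $\alpha=(\alpha_1,\dots,\alpha_n)$ runs over $n$-tuples of nonnegative integers, $|\alpha|=\alpha_1+\dots+\alpha_n$, $z^\alpha=z_1^{\alpha_1}\cdots z_n^{\alpha_n}$; $c_0=c_{0,\dots,0}$. For $r\geq0$ put $\mathcal{D}_r=r\mathcal{D}=\{rz:z\in\mathcal{D}\}$. For a domain $G\subset\mathbf{C}$, $\tilde G$ is its convex hull (so $\tilde G=G$ if $G$ is convex). For a domain $G\subset\mathbf{C}$ with $\tilde G\neq\mathbf{C}$: $R_1(\mathcal{D},G)\in[0,\infty]$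 is the supremum of all $r\geq0$ such that, for every holomorphic $f=\sum c_\alpha z^\alpha$ on $\mathcal{D}$ with $f(\mathcal{D})\subset G$, $$\sum_{|\alpha|\geq1}|c_\alpha z^\alpha|<\mathrm{dist}(c_0,\partial\tilde G)\quad\text{for all } z\in\mathcal{D}_r.$$ For bounded $\mathcal{D}$, $R_2(\mathcal{D},G)\in[0,\infty]$ is the supremum of all $r\geq0$ such that, for every holomorphic $f=\sum c_\alpha z^\alpha$ on $\mathcal{D}$ with $f(\mathcal{D})\subset G$, $$\sum_{|\alpha|\geq1}\ \sup_{z\in\mathcal{D}_r}|c_\alpha z^\alpha|<\mathrm{dist}(c_0,\partial\tilde G).$$ The sums of nonnegative terms are taken in $[0,\infty]$. *)

(* Defs.v *)
From HB Require Import structures.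
From mathcomp Require Import all_boot all_order all_algebra finmap.
From mathcomp Require Import complex.
From mathcomp Require Import all_classical all_reals all_analysis.

Set Implicit Arguments.
Unset Strict Implicit.
Unset Printing Implicit Defensive.

Import Order.TTheory GRing.Theory Num.Theory.
Import numFieldNormedType.Exports.

Local Open Scope classical_set_scope.
Local Open Scope ring_scope.
Local Open Scope complex_scope.

(* The complex numbers are R[i] for R : realType. The library derives the norm
   topology and the vector space structure of a numFieldType K over itself on
   K^o; this transports them to R[i] itself, as a normed space over R[i]. *)
HB.instance Definition _ (R : rcfType) := NormedModule.copy R[i] R[i]^o.

Definition domain (T : topologicalType) (A : set T) : Prop :=
  [/\ A !=set0, open A & connected A].

Section Bohr.
Variables (R : realType) (n : nat).
Local Notation C := R[i].
Local Notation multi_index := {ffun 'I_n -> nat}.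
Implicit Types (D : set 'rV[C]_n) (G : set C).

(* The order of R[i] is partial, but it is the usual one on the real numbers
   `|w 0 j| and `|z 0 j|. *)
Definition complete_Reinhardt D : Prop :=
  domain D /\
  forall z w : 'rV[C]_n,
    D z -> (forall j : 'I_n, `|w 0 j| <= `|z 0 j|) -> D w.

(* Frechet differentiability over the scalar field R[i], hence
   complex differentiability. *)
Definition holomorphic_on D (f : 'rV[C]_n -> C) : Prop :=
  forall z, D z -> differentiable f z.

Definition mi0 : multi_index := [ffun=> 0%N].

Definition mi_deg (a : multi_index) : nat := (\sum_(j < n) a j)%N.

Definition monomial (a : multi_index) (z : 'rV[C]_n) : C :=
  \prod_(j < n) z 0 j ^+ a j.

(* The family u, indexed by a set without preferred order, has sum s: its
   finite partial sums converge to s along the directed set of finite subsets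
   of the index set. *)
Definition unordered_sum (I : choiceType) (u : I -> C) (s : C) : Prop :=
  forall e : C, 0 < e ->
    exists A0 : {fset I}, forall A : {fset I},
      (A0 `<=` A)%fset -> `|\sum_(i <- A) u i - s| < e.

Definition power_series_on D (f : 'rV[C]_n -> C) (c : multi_index -> C) : Prop :=
  forall z, D z -> unordered_sum (fun a => c a * monomial a z) (f z).

Definition dilate (r : R) D : set 'rV[C]_n := [set r%:C *: z | z in D].

(* convex_set is taken in R[i] as a space over R[i], but its coefficients
   range over {i01 R[i]}, the t with 0 <= t <= 1, which are all real. *)
Definition convex_hull G : set C := smallest (@convex_set C C) G.

Definition boundary G : set C := closure G `\` interior G.

Definition dist (x : C) G : \bar R :=
  ereal_inf [set (Normc.normc (x - y))%:E | y in G].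

Definition bohr1_property D G (r : R) : Prop :=
  forall (f : 'rV[C]_n -> C) (c : multi_index -> C),
    holomorphic_on D f -> power_series_on D f c ->
    (forall z, D z -> G (f z)) ->
    forall z, dilate r D z ->
      (\esum_(a in [set a : multi_index | (1 <= mi_deg a)%N])
         (Normc.normc (c a * monomial a z))%:E
       < dist (c mi0) (boundary (convex_hull G)))%E.

Definition R1 D G : \bar R :=
  ereal_sup [set r%:E | r in [set r : R | 0 <= r /\ bohr1_property D G r]].

Definition bohr2_property D G (r : R) : Prop :=
  forall (f : 'rV[C]_n -> C) (c : multi_index -> C),
    holomorphic_on D f -> power_series_on D f c ->
    (forall z, D z -> G (f z)) ->
      (\esum_(a in [set a : multi_index | (1 <= mi_deg a)%N])
         ereal_sup [set (Normc.normc (c a * monomial a z))%:E | z in dilate r D]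
       < dist (c mi0) (boundary (convex_hull G)))%E.

Definition R2 D G : \bar R :=
  ereal_sup [set r%:E | r in [set r : R | 0 <= r /\ bohr2_property D G r]].

End Bohr.

(* Main.v *)
Require Import Defs.
From mathcomp Require Import all_boot all_order all_algebra finmap.
From mathcomp Require Import complex.
From mathcomp Require Import all_classical all_reals all_analysis.
From mathcomp Require Import ring lra.

Set Implicit Arguments.
Unset Strict Implicit.
Unset Printing Implicit Defensive.

Import Order.TTheory GRing.Theory Num.Theory.
Import numFieldNormedType.Exports.

Local Open Scope classical_set_scope.
Local Open Scope ring_scope.
Local Open Scope complex_scope.

(** The point is that any convex domain [G1] other than the plane can stand in
    for any other one, [G2], with no loss in the Bohr inequality.

    Every boundary point [q] of [G2] lies on the edge of an open half-plane
    containing [G2].  So if [f] maps [D] into [G2], then [F = u * (f - q)] has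
    positive real part for some constant [u], and the inequality to be proved
    for [f] is [sum_(a <> 0) |F_a z^a| <= |F_0|].  The function
    [g_s = (1 - exp (- s F)) / s] takes its values in the disc of centre [1/s]
    and radius [1/s], because [|exp (- s F)| < 1], and [g_s] tends to [F] as
    [s] tends to 0.  On the other hand [G1] contains a disc whose circle comes
    arbitrarily close to the boundary of [G1].  A similarity sends the disc of
    [g_s] onto that disc and the origin to a point close to the boundary of
    [G1].  The Bohr inequality for [G1] then reads
    [sum_(a <> 0) |(g_s)_a z^a| <= |(g_s)_0|] up to an arbitrarily small error,
    and [s -> 0] gives the inequality for [F].

    Since the exponential is entire, the power series of [g_s] comes from
    substituting the absolutely convergent series of [F] into that of [exp] and
    regrouping the terms by monomials; it converges wherever that of [F] does,
    so the expansion of [g_s] on all of [D] needs no Cauchy integral.  The same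
    computation bounds the coefficients of [g_s - F] by a multiple of [s].

    The passage to the limit loses strictness of the inequality.  It is
    recovered by shrinking [r] to [t * r] with [t < 1]: all the terms of the sum
    have degree at least one, so they are multiplied by at most [t].  This does
    not change the supremum of the admissible [r].

    Both radii are treated at once by evaluating the term of index [a] at a
    point [zeta a] that depends on [a] ([selector_bound]): constant functions
    [zeta] give the first radius, arbitrary ones the second, since a sum of
    suprema is the supremum over all choices of points.  The argument above is
    [selector_bound_transfer]; the equivalence with the Bohr properties is
    [bohr1_selector], [bohr2_selector], [selector_bohr1], [selector_bohr2]. *)

(** * The modulus of complex numbers as a real number *)

Section Modulus.
Variable R : realType.
Local Notation C := R[i].
Local Notation nc := (@Normc.normc R).
Implicit Types x y z : C.

Lemma normCE x : `|x| = (nc x)%:C. Proof. by []. Qed.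

Lemma nc_ge0 x : 0 <= nc x.
Proof. by rewrite -lecR -normCE normr_ge0. Qed.

Lemma nc0 : nc 0 = 0.
Proof. by rewrite /= expr0n /= addr0 sqrtr0. Qed.

Lemma nc_eq0 x : (nc x == 0) = (x == 0).
Proof.
by apply/eqP/eqP => [/Normc.eq0_normc //|->]; rewrite nc0.
Qed.

Lemma ncD x y : nc (x + y) <= nc x + nc y. Proof. exact: le_normcD. Qed.

Lemma ncN x : nc (- x) = nc x. Proof. exact: normcN. Qed.

Lemma ncB x y : nc (x - y) = nc (y - x). Proof. by rewrite -ncN opprB. Qed.

Lemma ncM x y : nc (x * y) = nc x * nc y. Proof. exact: Normc.normcM. Qed.

Lemma ncX x k : nc (x ^+ k) = nc x ^+ k.
Proof.
by elim: k => [|k IH]; rewrite ?expr0 ?Normc.normc1// !exprS ncM IH.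
Qed.

Lemma ncV x : nc x^-1 = (nc x)^-1. Proof. exact: Normc.normcV. Qed.

Lemma ncR (a : R) : nc a%:C = `|a|.
Proof. by rewrite /= expr0n /= addr0 sqrtr_sqr. Qed.

Lemma nc_tri x y z : nc (x - z) <= nc (x - y) + nc (y - z).
Proof. by rewrite -[x - z](subrKA y) ncD. Qed.

Lemma nc_sub x y : nc x <= nc (x - y) + nc y.
Proof. by rewrite -{1}(subrK y x) ncD. Qed.

Lemma nc_sum (I : Type) (r : seq I) (P : pred I) (u : I -> C) :
  nc (\sum_(i <- r | P i) u i) <= \sum_(i <- r | P i) nc (u i).
Proof.
elim/big_rec2: _ => [|i y x _ h]; first by rewrite nc0.
by rewrite (le_trans (ncD _ _))// lerD2l.
Qed.

Lemma Re_le_nc x : `|complex.Re x| <= nc x.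
Proof. by have := normc_ge_Re x; rewrite normCE lecR. Qed.

Lemma Im_le_nc x : `|complex.Im x| <= nc x.
Proof. by case: x => a b /=; rewrite -sqrtr_sqr ler_wsqrtr// lerDr sqr_ge0. Qed.

Lemma nc_le_ReIm x : nc x <= `|complex.Re x| + `|complex.Im x|.
Proof.
case: x => a b /=; rewrite -[leRHS]ger0_norm ?addr_ge0// -sqrtr_sqr.
rewrite ler_sqrt ?sqr_ge0// sqrrD !real_normK ?num_real//.
by rewrite addrAC lerDl mulrn_wge0// mulr_ge0.
Qed.

Lemma nc_conj x : nc x^*%C = nc x.
Proof. by case: x => a b /=; rewrite sqrrN. Qed.

Lemma Re_sum (I : Type) (r : seq I) (u : I -> C) :
  complex.Re (\sum_(i <- r) u i) = \sum_(i <- r) complex.Re (u i).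
Proof.
by elim/big_rec2: _ => // i y x _ <-; case: (u i) x => [a b] [c d].
Qed.

Lemma Im_sum (I : Type) (r : seq I) (u : I -> C) :
  complex.Im (\sum_(i <- r) u i) = \sum_(i <- r) complex.Im (u i).
Proof.
by elim/big_rec2: _ => // i y x _ <-; case: (u i) x => [a b] [c d].
Qed.

End Modulus.

(** * Unordered sums of complex families *)

Section UnorderedSum.
Variable R : realType.
Local Notation C := R[i].
Local Notation nc := (@Normc.normc R).

(** Absolute summability with an explicit bound: working with real bounds of
    finite partial sums avoids extended reals. *)
Definition abs_bounded (I : choiceType) (u : I -> C) (M : R) : Prop :=
  forall A : {fset I}, \sum_(i <- A) nc (u i) <= M.

Section OneIndex.
Variable I : choiceType.
Implicit Types (u v : I -> C) (s t : C) (A B : {fset I}).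

(** The order of [R[i]] is partial, so estimates are easier with a real
    tolerance; a positive complex number is real. *)
Lemma usumP u s : unordered_sum u s <->
  forall e : R, 0 < e -> exists A0 : {fset I}, forall A : {fset I},
    (A0 `<=` A)%fset -> nc (\sum_(i <- A) u i - s) < e.
Proof.
split=> h e e0.
  have [|A0 hA] := h e%:C; first by rewrite ltcR.
  by exists A0 => A /hA; rewrite normCE ltcR.
have er : (complex.Re e)%:C = e by rewrite RRe_real// gtr0_real.
have [|A0 hA] := h (complex.Re e); first by rewrite -ltcR er.
by exists A0 => A /hA; rewrite normCE -[in X in _ -> X]er ltcR.
Qed.

Lemma usum_unique u s t : unordered_sum u s -> unordered_sum u t -> s = t.
Proof.
move=> /usumP us /usumP ut; apply/eqP; rewrite -subr_eq0 -nc_eq0.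
rewrite eq_le nc_ge0 andbT; apply/ler_addgt0Pl => e e0; rewrite addr0.
have e2 : 0 < e / 2 by rewrite divr_gt0.
have [A0 h0] := us _ e2; have [A1 h1] := ut _ e2.
have {h0}h0 := h0 _ (fsubsetUl A0 A1); have {h1}h1 := h1 _ (fsubsetUr A0 A1).
rewrite (le_trans (nc_tri _ (\sum_(i <- (A0 `|` A1)%fset) u i) _))//.
by rewrite [e]splitr lerD// ltW// ncB.
Qed.

Lemma eq_usum u v s : u =1 v -> unordered_sum u s -> unordered_sum v s.
Proof. by move=> /funext ->. Qed.

Lemma usum_fin A u :
  (forall i, i \notin A -> u i = 0) -> unordered_sum u (\sum_(i <- A) u i).
Proof.
move=> u0; apply/usumP => e e0; exists A => B AB.
suff -> : \sum_(i <- B) u i = \sum_(i <- A) u i by rewrite subrr nc0.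
by apply/esym/big_fset_incl => // i _; exact: u0.
Qed.

Lemma usum0 : unordered_sum (fun _ : I => 0 : C) 0.
Proof. by have := @usum_fin fset0 (fun=> 0) (fun _ _ => erefl); rewrite big1. Qed.

Lemma usumD u v s t : unordered_sum u s -> unordered_sum v t ->
  unordered_sum (fun i => u i + v i) (s + t).
Proof.
move=> /usumP us /usumP vt; apply/usumP => e e0.
have e2 : 0 < e / 2 by rewrite divr_gt0.
have [A0 h0] := us _ e2; have [A1 h1] := vt _ e2.
exists (A0 `|` A1)%fset => A; rewrite fsubUset => /andP[/h0 a0 /h1 a1].
by rewrite big_split/= opprD addrACA (le_lt_trans (ncD _ _))// [e]splitr ltrD.
Qed.

Lemma usumZ (k : C) u s : unordered_sum u s ->
  unordered_sum (fun i => k * u i) (k * s).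
Proof.
move=> /usumP us; apply/usumP => e e0.
have k1 : 0 < nc k + 1 by rewrite ltr_wpDl ?nc_ge0.
have [A0 h0] := us (e / (nc k + 1)) (divr_gt0 e0 k1).
exists A0 => A /h0 h; rewrite -mulr_sumr -mulrBr ncM.
have [->|k0] := eqVneq (nc k) 0; first by rewrite mul0r.
rewrite (@le_lt_trans _ _ (nc k * (e / (nc k + 1))))//.
  by rewrite ler_wpM2l ?nc_ge0// ltW.
rewrite mulrCA gtr_pMr// ltr_pdivrMr// mul1r ltrDl//.
Qed.

Lemma usumN u s : unordered_sum u s -> unordered_sum (fun i => - u i) (- s).
Proof.
by move=> /(usumZ (-1)); rewrite mulN1r; apply: eq_usum => i; rewrite mulN1r.
Qed.

Lemma usumB u v s t : unordered_sum u s -> unordered_sum v t ->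
  unordered_sum (fun i => u i - v i) (s - t).
Proof. by move=> us /usumN; exact: usumD. Qed.

Lemma usum_sum (J : eqType) (r : seq J) (u : J -> I -> C) (s : J -> C) :
  (forall j, j \in r -> unordered_sum (u j) (s j)) ->
  unordered_sum (fun i => \sum_(j <- r) u j i) (\sum_(j <- r) s j).
Proof.
elim: r => [|j r IH] h.
  by rewrite big_nil; apply: eq_usum usum0 => i; rewrite big_nil.
rewrite big_cons; apply: (@eq_usum (fun i => u j i + \sum_(j <- r) u j i)).
  by move=> i; rewrite big_cons.
apply: usumD; first by apply: h; rewrite mem_head.
by apply: IH => k kr; apply: h; rewrite in_cons kr orbT.
Qed.

Lemma usum_conj u s : unordered_sum u s ->
  unordered_sum (fun i => (u i)^*%C) s^*%C.
Proof.
move=> /usumP us; apply/usumP => e /us[A0 h0]; exists A0 => A /h0.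
by rewrite -rmorph_sum -rmorphB nc_conj.
Qed.

Lemma abs_bounded_ge0 u M : abs_bounded u M -> 0 <= M.
Proof. by move=> /(_ fset0); rewrite big_seq_fset0. Qed.

Lemma abs_bounded_le u v M : (forall i, nc (v i) <= nc (u i)) ->
  abs_bounded u M -> abs_bounded v M.
Proof. by move=> vu uM A; rewrite (le_trans _ (uM A))// ler_sum. Qed.

Lemma abs_boundedZ (k : C) u M : abs_bounded u M ->
  abs_bounded (fun i => k * u i) (nc k * M).
Proof.
move=> uM A; under eq_bigr do rewrite ncM.
by rewrite -mulr_sumr ler_wpM2l ?nc_ge0.
Qed.

Lemma ler_sum_fsubset A B (g : I -> R) : (A `<=` B)%fset ->
  (forall i, 0 <= g i) -> \sum_(i <- A) g i <= \sum_(i <- B) g i.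
Proof.
move=> AB g0; rewrite [leRHS](big_fsetID _ (mem A))/=.
have -> : [fset x | x in B & x \in A]%fset = A.
  apply/fsetP => x; rewrite !inE/= andbC; apply/andb_idr => xA.
  exact: (fsubsetP AB).
by rewrite lerDl sumr_ge0.
Qed.

Lemma usum_nc_le u s M : unordered_sum u s -> abs_bounded u M -> nc s <= M.
Proof.
move=> /usumP us uM; apply/ler_addgt0Pl => e /us[A0 /(_ A0 (fsubset_refl _)) h].
rewrite (le_trans (nc_sub _ (\sum_(i <- A0) u i)))// lerD//.
  by rewrite ncB ltW.
by rewrite (le_trans (nc_sum _ _ _)).
Qed.

(** The terms of each sign form a finite subfamily, so the sum of their absolute
    values is one of the partial sums bounded by [K], up to sign. *)
Lemma real_abs_bound (g : I -> R) K :
  (forall A, `|\sum_(i <- A) g i| <= K) ->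
  forall A, \sum_(i <- A) `|g i| <= 2 * K.
Proof.
move=> gK A; rewrite (bigID (fun i => 0 <= g i))/= mulr2n mulrDl mul1r lerD//.
  rewrite (eq_bigr g); last by move=> i /ger0_norm.
  by rewrite big_fset_condE/= (le_trans (ler_norm _)).
rewrite (eq_bigr (fun i => - g i)); last first.
  by move=> i; rewrite -ltNge => /ltr0_norm.
by rewrite big_fset_condE/= sumrN (le_trans (ler_norm _))// normrN.
Qed.

(** Unconditional convergence is absolute convergence in finite dimension.  The
    finite partial sums are bounded because adding the fixed finite set given by
    the convergence for tolerance 1 brings them near [s]. *)
Lemma usum_abs_bounded u s : unordered_sum u s -> exists M, abs_bounded u M.
Proof.
move=> /usumP us; have [A0 h0] := us 1 ltr01.
pose K := 1 + nc s + \sum_(i <- A0) nc (u i).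
have uK A : nc (\sum_(i <- A) u i) <= K.
  have -> : \sum_(i <- A) u i =
      \sum_(i <- (A0 `|` A)%fset) u i - \sum_(i <- (A0 `\` A)%fset) u i.
    rewrite (big_fsetID _ (mem A) (A0 `|` A)%fset)/=.
    have -> : [fset x | x in A0 `|` A & x \in A]%fset = A.
      by apply/fsetP => x; rewrite !inE/=; case: (x \in A); rewrite ?orbT ?andbF.
    have -> : [fset x | x in A0 `|` A & x \notin A]%fset = (A0 `\` A)%fset.
      by apply/fsetP => x; rewrite !inE/=; case: (x \in A); rewrite ?orbF ?andbT ?andbF.
    by rewrite addrK.
  rewrite (le_trans (ncD _ _))// ncN /K lerD//.
    rewrite (le_trans (nc_sub _ s))// lerD2r ltW// h0// fsubsetUl//.
  rewrite (le_trans (nc_sum _ _ _))// ler_sum_fsubset ?fsubsetDl// => i.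
  exact: nc_ge0.
exists (2 * K + 2 * K) => A.
apply: (@le_trans _ _ (\sum_(i <- A) (`|complex.Re (u i)| + `|complex.Im (u i)|))).
  by apply: ler_sum => i _; exact: nc_le_ReIm.
rewrite big_split/= lerD//; apply: real_abs_bound => B.
  by rewrite -Re_sum (le_trans (Re_le_nc _)).
by rewrite -Im_sum (le_trans (Im_le_nc _)).
Qed.

Lemma nonneg_usum (g : I -> R) M : (forall i, 0 <= g i) ->
  (forall A, \sum_(i <- A) g i <= M) ->
  exists s, unordered_sum (fun i => (g i)%:C) s.
Proof.
move=> g0 gM; pose E := [set \sum_(i <- A) g i | A in [set: {fset I}]].
have E0 : E !=set0 by exists (\sum_(i <- fset0) g i); exists fset0.
have Eub : has_ubound E by exists M => _ [A _ <-].
exists (sup E)%:C; apply/usumP => e e0.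
have [_ [A0 _ <-] h0] := sup_adherent e0 (conj E0 Eub).
exists A0 => A A0A; rewrite -rmorph_sum -rmorphB ncR.
have le1 : \sum_(i <- A) g i <= sup E by apply: ub_le_sup => //; exists A.
rewrite ler0_norm ?subr_le0// opprB ltrBlDr -ltrBlDl.
by rewrite (lt_le_trans h0)// ler_sum_fsubset.
Qed.

Lemma real_usum (g : I -> R) M : abs_bounded (fun i => (g i)%:C) M ->
  exists s, unordered_sum (fun i => (g i)%:C) s.
Proof.
move=> gM.
have gM' A : \sum_(i <- A) `|g i| <= M.
  by rewrite (le_trans _ (gM A))// ler_sum// => i _; rewrite ncR.
have [s hs] : exists s, unordered_sum (fun i => (`|g i|)%:C) s.
  exact: nonneg_usum gM'.
have [t ht] : exists s, unordered_sum (fun i => (`|g i| + g i)%:C) s.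
  apply: (@nonneg_usum _ (M + M)) => [i|A].
    by rewrite -lerBlDr sub0r -normrN ler_norm.
  rewrite big_split/= lerD// (le_trans _ (gM' A))// ler_sum// => i _.
  exact: ler_norm.
exists (t - s); apply: eq_usum (usumB ht hs) => i.
by rewrite -rmorphB addrC addKr.
Qed.

(** Completeness: the real and imaginary parts are differences of nonnegative
    families, whose sums are suprema. *)
Lemma abs_bounded_usum u M : abs_bounded u M -> exists s, unordered_sum u s.
Proof.
move=> uM.
have [s hs] : exists s, unordered_sum (fun i => (complex.Re (u i))%:C) s.
  apply: (@real_usum _ M); apply: abs_bounded_le uM => i.
  by rewrite ncR Re_le_nc.
have [t ht] : exists s, unordered_sum (fun i => (complex.Im (u i))%:C) s.
  apply: (@real_usum _ M); apply: abs_bounded_le uM => i.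
  by rewrite ncR Im_le_nc.
exists (s + 'i%C * t); apply: eq_usum (usumD hs (usumZ 'i%C ht)) => i.
by rewrite [RHS]complexE.
Qed.

(** If the partial sum over [A0] is within [e] of the supremum of all partial
    sums, then any finite set outside [A0] contributes at most [e]. *)
Lemma abs_bounded_tail u M : abs_bounded u M -> forall e : R, 0 < e ->
  exists A0 : {fset I}, abs_bounded (fun i => if i \in A0 then 0 else u i) e.
Proof.
move=> uM e e0; pose E := [set \sum_(i <- A) nc (u i) | A in [set: {fset I}]].
have E0 : E !=set0 by exists (\sum_(i <- fset0) nc (u i)); exists fset0.
have Eub : has_ubound E by exists M => _ [A _ <-].
have [_ [A0 _ <-] h0] := sup_adherent e0 (conj E0 Eub).
exists A0 => A.
have le1 : \sum_(i <- (A0 `|` A)%fset) nc (u i) <= sup E.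
  by apply: ub_le_sup => //; exists (A0 `|` A)%fset.
rewrite (eq_bigr (fun i => if i \notin A0 then nc (u i) else 0)); last first.
  by move=> i _; case: ifP; rewrite ?nc0.
rewrite -big_mkcond/= big_fset_condE/=.
have -> : [fset i | i in A & i \notin A0]%fset = (A `\` A0)%fset.
  by apply/fsetP => x; rewrite !inE/= andbC.
rewrite (big_fsetID _ (mem A0) (A0 `|` A)%fset)/= in le1.
move: le1; have -> : [fset x | x in A0 `|` A & x \in A0]%fset = A0.
  by apply/fsetP => x; rewrite !inE/=; case: (x \in A0); rewrite ?andbF.
have -> : [fset x | x in A0 `|` A & x \notin A0]%fset = (A `\` A0)%fset.
  by apply/fsetP => x; rewrite !inE/=; case: (x \in A0); rewrite ?andbT ?andbF.
by move=> le1; lra.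
Qed.

End OneIndex.

Section Grouping.
Variables (I J : choiceType) (p : I -> J).

(** The weight [k] is 1 for summing up the fibres and a phase for summing up
    their moduli. *)
Lemma sum_fiber (u : I -> C) (k : J -> C) (B : {fset J}) i :
  \sum_(j <- B) k j * (if p i == j then u i else 0) =
  if p i \in B then k (p i) * u i else 0.
Proof.
case: ifPn => [piB|piB].
  rewrite (big_fsetD1 (p i))//= eqxx big1_fset ?addr0// => j.
  by rewrite !inE eq_sym => /andP[/negPf-> _] _; rewrite mulr0.
rewrite big1_fset// => j jB _; case: eqP => [pij|]; last by rewrite mulr0.
by rewrite pij jB in piB.
Qed.

(** Regrouping by the fibres of [p].  The sum of the fibre sums over a finite
    set [B] is the sum of [u] over the preimage of [B], so it misses at most a
    tail of [u]; and multiplying each fibre sum by its conjugate phase turns the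
    sum of moduli into a sum of a family dominated by [u]. *)
Lemma usum_group (u : I -> C) M s (S : J -> C) :
  abs_bounded u M -> unordered_sum u s ->
  (forall j, unordered_sum (fun i => if p i == j then u i else 0) (S j)) ->
  unordered_sum S s /\ abs_bounded S M.
Proof.
move=> uM us uS; split.
  apply/usumP => e e0.
  have e2 : 0 < e / 2 by rewrite divr_gt0.
  have [A0 h0] := abs_bounded_tail uM e2.
  exists (p @` A0)%fset => B /fsubsetP A0B.
  have h1 : unordered_sum (fun i => (if p i \in B then u i else 0) - u i)
              (\sum_(j <- B) S j - s).
    apply: usumB => //.
    apply: eq_usum (@usum_sum _ _ B _ _ (fun j _ => uS j)) => i.
    rewrite -(eq_bigr _ (fun j _ => mul1r _)) (@sum_fiber u (fun=> 1)).
    by rewrite mul1r.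
  rewrite (@le_lt_trans _ _ (e / 2))//; last by rewrite gtr_pMr// invf_lt1// ltr1n.
  apply: (usum_nc_le h1); apply: abs_bounded_le h0 => i.
  case: ifPn => piB; first by rewrite subrr nc0 nc_ge0.
  rewrite sub0r ncN; case: ifPn => // iA0.
  by rewrite A0B ?in_imfset in piB.
(* The conjugate phase of [S j]; it is 0 when [S j = 0], where any value of
   modulus at most 1 would do. *)
move=> B; pose k j : C := (nc (S j))%:C / S j.
have kS j : k j * S j = (nc (S j))%:C.
  rewrite /k; have [->|S0] := eqVneq (S j) 0; first by rewrite nc0 mulr0.
  by rewrite divfK.
have k1 j : nc (k j) <= 1.
  rewrite ncM ncV ncR ger0_norm ?nc_ge0//.
  have [->|S0] := eqVneq (nc (S j)) 0; first by rewrite mul0r.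
  by rewrite divff.
have h1 : unordered_sum (fun i => if p i \in B then k (p i) * u i else 0)
            (\sum_(j <- B) k j * S j).
  apply: eq_usum (@usum_sum _ _ B _ _ (fun j _ => usumZ (k j) (uS j))) => i.
  exact: sum_fiber.
have h2 : nc (\sum_(j <- B) k j * S j) <= M.
  apply: (usum_nc_le h1); apply: abs_bounded_le uM => i.
  case: ifPn => _; last by rewrite nc0 nc_ge0.
  by rewrite ncM ler_piMl ?nc_ge0.
apply: le_trans h2; under [in leRHS]eq_bigr do rewrite kS.
by rewrite -rmorph_sum ncR ler_norm.
Qed.

End Grouping.

Section Products.
Variables (I J : choiceType).

Lemma abs_bounded_prod (w : I * J -> C) (m : I -> R) M :
  (forall i, abs_bounded (fun j => w (i, j)) (m i)) ->
  (forall A : {fset I}, \sum_(i <- A) m i <= M) ->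
  abs_bounded w M.
Proof.
move=> wm mM A.
pose A1 := [fset k.1 | k in A]%fset; pose A2 := [fset k.2 | k in A]%fset.
apply: (@le_trans _ _ (\sum_(i <- A1) \sum_(j <- A2) nc (w (i, j)))); last first.
  by rewrite (le_trans _ (mM A1))// ler_sum// => i _; exact: wm.
rewrite pair_big_dep_cond/=.
under [leRHS]eq_bigr do rewrite -surjective_pairing.
apply: ler_sum_fsubset => [|k]; last exact: nc_ge0.
apply/fsubsetP => -[i j] ijA; apply/imfset2P; exists i => /=.
  by rewrite !inE/= andbT; apply/imfsetP; exists (i, j).
exists j => //=; rewrite !inE/= andbT; apply/imfsetP; exists (i, j) => //.
Qed.

(** The family carried by one row of [I * J] has the sum of that row: enlarging
    a finite set of pairs inside the row does not change the partial sum over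
    the pairs outside it, which vanish. *)
Lemma usum_slice (w : I * J -> C) M (i0 : I) t : abs_bounded w M ->
  unordered_sum (fun j => w (i0, j)) t ->
  unordered_sum (fun k => if k.1 == i0 then w k else 0) t.
Proof.
move=> wM /usumP wt; set v := fun k => _.
have [t' vt'] : exists t', unordered_sum v t'.
  apply: (@abs_bounded_usum _ _ M); apply: abs_bounded_le wM => k.
  by rewrite /v; case: ifP; rewrite ?nc0 ?nc_ge0.
suff <- : t' = t by [].
apply/eqP; rewrite -subr_eq0 -nc_eq0.
rewrite eq_le nc_ge0 andbT; apply/ler_addgt0Pl => e e0; rewrite addr0.
have e2 : 0 < e / 2 by rewrite divr_gt0.
have /usumP/(_ _ e2)[A0 h0] := vt'; have [B0 h1] := wt _ e2.
pose B := (B0 `|` [fset k.2 | k in A0])%fset.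
have {h1}h1 := h1 B (fsubsetUl _ _).
have {h0}h0 := h0 (A0 `|` [fset (i0, j) | j in B])%fset (fsubsetUl _ _).
rewrite (le_trans (nc_tri _ (\sum_(j <- B) w (i0, j)) _))//.
rewrite [e]splitr lerD//; last exact: ltW.
suff <- : \sum_(k <- (A0 `|` [fset (i0, j) | j in B])%fset) v k =
          \sum_(j <- B) w (i0, j) by rewrite ncB ltW.
rewrite -(@big_fset_incl _ _ _ _ [fset (i0, j) | j in B]%fset)/=.
- rewrite big_imfset/=; last by move=> j j' _ _ [].
  by apply: eq_bigr => j _; rewrite /v/= eqxx.
- exact: fsubsetUr.
- move=> [i j]; rewrite inE => /orP[ijA|-> //] /negP ijB.
  rewrite /v/=; case: eqP => // ii0; case: ijB; rewrite ii0.
  apply/imfsetP; exists j => //=; rewrite !inE/=; apply/orP; right.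
  by apply/imfsetP; exists (i, j).
Qed.

(** Fubini for absolutely summable families: group by the first index. *)
Lemma usum_iter (w : I * J -> C) M s (S : I -> C) :
  abs_bounded w M -> unordered_sum w s ->
  (forall i, unordered_sum (fun j => w (i, j)) (S i)) ->
  unordered_sum S s.
Proof.
move=> wM ws wS; have [] // := @usum_group _ _ fst w M s S wM ws.
by move=> i; exact: (usum_slice wM).
Qed.

Lemma abs_bounded_mul (u : I -> C) (v : J -> C) M N :
  abs_bounded u M -> abs_bounded v N ->
  abs_bounded (fun k : I * J => u k.1 * v k.2) (M * N).
Proof.
move=> uM vN; apply: (@abs_bounded_prod _ (fun i => nc (u i) * N)) => [i|A].
  exact: (abs_boundedZ (u i) vN).
by rewrite -mulr_suml ler_wpM2r// (abs_bounded_ge0 vN).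
Qed.

Lemma usum_mul (u : I -> C) (v : J -> C) s t :
  unordered_sum u s -> unordered_sum v t ->
  unordered_sum (fun k : I * J => u k.1 * v k.2) (s * t).
Proof.
move=> us vt; have [M uM] := usum_abs_bounded us.
have [N vN] := usum_abs_bounded vt.
have uv := abs_bounded_mul uM vN.
have [x hx] := abs_bounded_usum uv.
have h : unordered_sum (fun i => u i * t) x.
  by apply: (usum_iter uv hx) => i; exact: (usumZ (u i) vt).
suff <- : x = s * t by [].
apply: usum_unique h _; rewrite mulrC; apply: eq_usum (usumZ t us) => i.
exact: mulrC.
Qed.

End Products.

End UnorderedSum.

(** * The complex exponential *)

Section ComplexExponential.
Variable R : realType.
Local Notation C := R[i].
Local Notation nc := (@Normc.normc R).
Implicit Types w v h : C.

Definition exp_term w (k : nat) : C := w ^+ k / k`!%:R.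

Definition fset_below (N : nat) : {fset nat} := [fset k | k in iota 0 N]%fset.

Lemma in_fset_below (N k : nat) : (k \in fset_below N) = (k < N)%N.
Proof.
by apply/imfsetP/idP => [[x /= + ->]|kN]; [|exists k]; rewrite //= mem_iota.
Qed.

Lemma sum_fset_below (V : nmodType) (N : nat) (g : nat -> V) :
  \sum_(k <- fset_below N) g k = \sum_(0 <= k < N) g k.
Proof.
apply: perm_big; apply: uniq_perm; rewrite ?iota_uniq ?fset_uniq// => k.
by rewrite in_fset_below mem_index_iota.
Qed.

Lemma sub_fset_below (A : {fset nat}) :
  exists N0, forall N, (N0 <= N)%N -> (A `<=` fset_below N)%fset.
Proof.
exists (\max_(k <- A) k).+1 => N AN; apply/fsubsetP => k kA.
rewrite in_fset_below (leq_trans _ AN)// ltnS.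
exact: leq_bigmax_seq.
Qed.

Lemma nc_nat (k : nat) : nc k%:R = k%:R.
Proof. by rewrite -(rmorph_nat (real_complex R)) ncR ger0_norm. Qed.

Lemma nc_exp_term w k : nc (exp_term w k) = exp_coeff (nc w) k.
Proof. by rewrite /exp_term ncM ncV ncX nc_nat. Qed.

Lemma abs_bounded_exp w : abs_bounded (exp_term w) (expR (nc w)).
Proof.
move=> A; have [N /(_ N (leqnn _)) AN] := sub_fset_below A.
under eq_bigr do rewrite nc_exp_term.
have c0 k : 0 <= exp_coeff (nc w) k by apply: exp_coeff_ge0; exact: nc_ge0.
apply: (le_trans (ler_sum_fsubset AN c0)); rewrite sum_fset_below.
rewrite /expR; apply: (nondecreasing_cvgn_le _ (is_cvg_series_exp_coeff _)).
by apply: nondecreasing_series => k _ _; exact: c0.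
Qed.

Definition cexp w : C := xget 0 [set s | unordered_sum (exp_term w) s].

Lemma cexpP w : unordered_sum (exp_term w) (cexp w).
Proof.
rewrite /cexp; have [s hs] := abs_bounded_usum (abs_bounded_exp w).
exact: (xgetPex 0 (ex_intro _ s hs)).
Qed.

Lemma usum_real_series (g : nat -> R) (l : R) (s : C) :
  unordered_sum (fun k => (g k)%:C) s -> series g @ \oo --> l -> s = l%:C.
Proof.
move=> /usumP gs /cvgrPdist_lt gl; apply/eqP; rewrite -subr_eq0 -nc_eq0.
rewrite eq_le nc_ge0 andbT; apply/ler_addgt0Pl => e e0; rewrite addr0.
have e2 : 0 < e / 2 by rewrite divr_gt0.
have [A0 h0] := gs _ e2; have [N0 AN] := sub_fset_below A0.
have [N1 _ h1] := gl _ e2; pose N := maxn N0 N1.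
have {}h0 := h0 _ (AN N (leq_maxl _ _)).
have {}h1 := h1 N (leq_maxr _ _).
rewrite (le_trans (nc_tri _ (\sum_(i <- fset_below N) (g i)%:C) _))//.
rewrite [e]splitr lerD//; first by rewrite ncB ltW.
rewrite sum_fset_below -rmorph_sum -rmorphB ncR distrC.
exact: ltW.
Qed.

Lemma cexp_real (x : R) : cexp x%:C = (expR x)%:C.
Proof.
apply: (@usum_real_series (exp_coeff x)).
  apply: eq_usum (cexpP x%:C) => k.
  by rewrite /exp_term /exp_coeff /= rmorphM rmorphXn fmorphV rmorph_nat.
exact: is_cvg_series_exp_coeff.
Qed.

Lemma cexp_conj w : cexp w^*%C = (cexp w)^*%C.
Proof.
apply: usum_unique (cexpP _) _; apply: eq_usum (usum_conj (cexpP w)) => k.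
by rewrite /exp_term rmorphM rmorphXn fmorphV rmorph_nat.
Qed.

(** Group the products of terms along the antidiagonals [i + j = n]: the
    binomial formula makes each group a term of the series of [w + v]. *)
Lemma cexpD w v : cexp (w + v) = cexp w * cexp v.
Proof.
have ewv := usum_mul (cexpP w) (cexpP v).
have bwv := abs_bounded_mul (abs_bounded_exp w) (abs_bounded_exp v).
apply: usum_unique (cexpP _) _.
have [] // := @usum_group _ _ _ (fun k => (k.1 + k.2)%N) _ _ _ (exp_term (w + v)) bwv ewv.
move=> n; set u := fun k : nat * nat => _.
pose A := [fset (n - k, k)%N | k in fset_below n.+1]%fset.
suff <- : \sum_(k <- A) u k = exp_term (w + v) n.
  apply: usum_fin => -[i j] ijA; rewrite /u/=; case: eqP => // ijn.
  case/negP: ijA; apply/imfsetP; exists j => /=; last by rewrite -ijn addnK.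
  by rewrite in_fset_below -ijn ltnS leq_addl.
rewrite /A big_imfset/=; last by move=> i j _ _ [].
rewrite sum_fset_below big_mkord /exp_term exprDn mulr_suml.
apply: eq_bigr => -[i /= iN] _; rewrite /u/= subnK// eqxx /exp_term.
have nz m : (m`!)%:R != 0 :> C by rewrite pnatr_eq0 -lt0n fact_gt0.
rewrite -mulr_natr -(bin_fact (iN : (i <= n)%N)) !natrM.
have bz : ('C(n, i))%:R != 0 :> C by rewrite pnatr_eq0 -lt0n bin_gt0.
by field; rewrite !nz bz.
Qed.

(** [|exp w|^2 = exp w * exp (conj w) = exp (w + conj w) = exp (2 Re w)]. *)
Lemma nc_cexp w : nc (cexp w) = expR (complex.Re w).
Proof.
have h : (nc (cexp w) ^+ 2)%:C = (expR (complex.Re w) ^+ 2)%:C.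
  transitivity (`|cexp w| ^+ 2); first by rewrite (rmorphXn (real_complex R)).
  rewrite sqr_normc -cexp_conj -cexpD addcJ.
  rewrite -(rmorph_nat (real_complex R)) -rmorphM cexp_real.
  by rewrite expr2 -expRD mulr_natl mulr2n.
have /eqP : nc (cexp w) ^+ 2 = expR (complex.Re w) ^+ 2 by case: h.
by rewrite eqrXn2 ?nc_ge0 ?expR_ge0// => /eqP.
Qed.

Lemma usum_exp_tail2 w :
  unordered_sum (fun k => if (k < 2)%N then 0 else exp_term w k)
    (cexp w - 1 - w).
Proof.
have f01 : unordered_sum (fun k => if (k < 2)%N then exp_term w k else 0) (1 + w).
  have := @usum_fin R nat (fset_below 2) (fun k => if (k < 2)%N then exp_term w k else 0).
  rewrite sum_fset_below big_nat_recl//= big_nat1/= /exp_term expr0 expr1 !divr1.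
  by apply => k; rewrite in_fset_below => /negPf->.
rewrite -addrA -opprD; apply: eq_usum (usumB (cexpP w) f01) => k.
by case: ifP; rewrite ?subrr ?subr0.
Qed.

(** For [k >= 2] the [k]-th term is at most [|w|^2 / k!], as [|w| <= 1]. *)
Lemma cexp_taylor1 w : nc w <= 1 ->
  nc (cexp w - 1 - w) <= nc w ^+ 2 * expR 1.
Proof.
move=> w1; apply: (usum_nc_le (usum_exp_tail2 w)) => A.
apply: (@le_trans _ _ (\sum_(k <- A) nc ((nc w ^+ 2)%:C * exp_term 1 k))).
  apply: ler_sum => k _; rewrite ncM ncR ger0_norm ?exprn_ge0 ?nc_ge0//.
  rewrite nc_exp_term Normc.normc1; case: ltnP => k2.
    by rewrite nc0 mulr_ge0 ?exprn_ge0 ?nc_ge0// exp_coeff_ge0.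
  rewrite nc_exp_term /exp_coeff/= expr1n mul1r ler_wpM2r ?invr_ge0//.
  by rewrite ler_wiXn2l ?nc_ge0.
rewrite (le_trans (abs_boundedZ _ (abs_bounded_exp 1) A))//.
by rewrite ncR ger0_norm ?exprn_ge0 ?nc_ge0// Normc.normc1.
Qed.

(** By [cexpD] the difference quotient at [w] is [cexp w] times the one at 0,
    which [cexp_taylor1] controls. *)
Lemma differentiable_cexp w : differentiable (cexp : C -> C) w.
Proof.
apply/derivable1_diffP/cvg_ex; exists (cexp w).
apply/cvgrPdist_lt => e; rewrite ltcE/= => /andP[/eqP ei e0].
pose K := nc (cexp w) * expR 1 + 1.
have K0 : 0 < K by rewrite ltr_wpDl// mulr_ge0 ?nc_ge0 ?expR_ge0.
pose d := Num.min 1 (complex.Re e / K).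
have d0 : 0 < d by rewrite lt_min ltr01 divr_gt0.
apply/nbhs_ballP; exists d%:C; first by rewrite /= ltcR.
move=> h; rewrite /ball/= sub0r normrN normCE ltcR lt_min => /andP[h1 hK] hn0.
have eE : e = (complex.Re e)%:C by case: e ei {e0 d d0 hK} => a b /= ->.
rewrite normCE eE ltcR.
have h0 : 0 < nc h by rewrite lt_neqAle nc_ge0 andbT eq_sym nc_eq0.
rewrite /GRing.scale/= mulr1 cexpD.
have -> : cexp w - h^-1 * (cexp h * cexp w - cexp w) =
    - (cexp w * (h^-1 * (cexp h - 1 - h))) by field.
rewrite ncN !ncM ncV.
apply: (@le_lt_trans _ _ (nc h * K)); last by rewrite -ltr_pdivlMr.
rewrite /K mulrDr mulr1 ler_wpDr ?nc_ge0// [leRHS]mulrCA ler_wpM2l ?nc_ge0//.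
by rewrite ler_pdivrMl// mulrA -expr2 cexp_taylor1// ltW.
Qed.

End ComplexExponential.

(** * Power series on complete Reinhardt domains *)

Section PowerSeries.
Variables (R : realType) (n : nat).
Local Notation C := R[i].
Local Notation nc := (@Normc.normc R).
Local Notation multi_index := {ffun 'I_n -> nat}.
Local Notation mi0 := (mi0 n).
Implicit Types (D : set 'rV[C]_n) (a b : multi_index) (z : 'rV[C]_n).

Lemma monomial0 z : monomial mi0 z = 1.
Proof. by rewrite /monomial big1// => j _; rewrite ffunE. Qed.

Lemma monomial_at0 a : (1 <= mi_deg a)%N -> monomial a (0 : 'rV[C]_n) = 0.
Proof.
rewrite lt0n sum_nat_eq0 => /forallPn[j]; rewrite negb_imply/= => aj.
by rewrite /monomial (bigD1 j)//= mxE expr0n (negPf aj) mul0r.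
Qed.

Lemma mi_deg_eq0 a : (mi_deg a == 0%N) = (a == mi0).
Proof.
apply/idP/eqP => [|->]; last first.
  by rewrite sum_nat_eq0; apply/forallP => j; rewrite ffunE.
by rewrite sum_nat_eq0 => /forallP h; apply/ffunP => j; rewrite ffunE; apply/eqP/h.
Qed.

Definition mi_add a b : multi_index := [ffun j => (a j + b j)%N].

Lemma monomialD a b z : monomial (mi_add a b) z = monomial a z * monomial b z.
Proof.
by rewrite /monomial -big_split/=; apply: eq_bigr => j _; rewrite ffunE exprD.
Qed.

Lemma monomialZ (t : C) a z :
  monomial a (t *: z) = t ^+ mi_deg a * monomial a z.
Proof.
rewrite /monomial /mi_deg -prodrXr -big_split/=.
by apply: eq_bigr => j _; rewrite mxE exprMn.
Qed.

Lemma Reinhardt0 D : complete_Reinhardt D -> D 0.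
Proof.
move=> [[[z Dz] _ _] DR]; apply: (DR z) => // j.
by rewrite mxE normr0 normr_ge0.
Qed.

(** Such a point serves to read off coefficients: no monomial vanishes there, so
    bounds on the terms of a series become bounds on its coefficients. *)
Lemma Reinhardt_coord_neq0 D : complete_Reinhardt D ->
  exists2 z, D z & forall j, z 0 j != 0.
Proof.
move=> rD; have D0 := Reinhardt0 rD; case: rD => -[_ oD _] _.
have /nbhs_ballP[e e0 De] : nbhs (0 : 'rV[C]_n) D by exact: open_nbhs_nbhs.
exists (const_mx (e / 2)).
  apply: De; split=> // i j; rewrite !mxE /ball/= sub0r normrN.
  by rewrite gtr0_norm ?divr_gt0// ltr_pdivrMr// ltr_pMr// ltr1n.
by move=> j; rewrite mxE gt_eqF// divr_gt0.
Qed.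

Lemma monomial_neq0 a z : (forall j, z 0 j != 0) -> monomial a z != 0.
Proof. by move=> z0; apply/prodf_neq0 => j _; rewrite expf_neq0. Qed.

(** [m] bounds the sum of the moduli of the terms; carrying it along is what
    makes substitution into the exponential series possible. *)
Definition has_series D (h : 'rV[C]_n -> C) (c : multi_index -> C)
    (m : 'rV[C]_n -> R) : Prop :=
  power_series_on D h c /\
  forall z, D z -> abs_bounded (fun a => c a * monomial a z) (m z).

(** A series of monomials in which the same exponent may occur for many indices
    [k] becomes a power series by collecting equal exponents.  The coefficients
    converge because the series does at a point where no monomial vanishes. *)
Lemma regroup_series D (K : choiceType) (ix : K -> multi_index) (wt : K -> C)
    (h : 'rV[C]_n -> C) (m : 'rV[C]_n -> R) :
  complete_Reinhardt D ->
  (forall z, D z -> unordered_sum (fun k => wt k * monomial (ix k) z) (h z)) ->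
  (forall z, D z -> abs_bounded (fun k => wt k * monomial (ix k) z) (m z)) ->
  exists c, has_series D h c m.
Proof.
move=> /Reinhardt_coord_neq0[z0 Dz0 z0j] hs hb.
have /choice[c hc] : forall a, exists s,
    unordered_sum (fun k => if ix k == a then wt k else 0) s.
  move=> a; have ma0 := monomial_neq0 a z0j.
  apply: (@abs_bounded_usum _ _ _ (nc (monomial a z0)^-1 * m z0)).
  apply: abs_bounded_le (abs_boundedZ (monomial a z0)^-1 (hb _ Dz0)) => k.
  case: eqP => [->|_]; last by rewrite nc0 nc_ge0.
  by rewrite mulrC mulfK.
exists c; suff h0 z : D z ->
    unordered_sum (fun a => c a * monomial a z) (h z) /\
    abs_bounded (fun a => c a * monomial a z) (m z).
  by split=> z Dz; have [] := h0 z Dz.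
move=> Dz; apply: (usum_group (p := ix) (hb _ Dz) (hs _ Dz)) => a.
rewrite mulrC; apply: eq_usum (usumZ (monomial a z) (hc a)) => k.
by case: eqP => [->|]; rewrite ?mulr0// mulrC.
Qed.

Lemma has_series_mul D h1 h2 c1 c2 m1 m2 : complete_Reinhardt D ->
  has_series D h1 c1 m1 -> has_series D h2 c2 m2 ->
  exists c, has_series D (fun z => h1 z * h2 z) c (fun z => m1 z * m2 z).
Proof.
move=> rD [s1 b1] [s2 b2].
have E z (k : multi_index * multi_index) :
    (c1 k.1 * monomial k.1 z) * (c2 k.2 * monomial k.2 z) =
    c1 k.1 * c2 k.2 * monomial (mi_add k.1 k.2) z.
  by rewrite monomialD mulrACA.
apply: (regroup_series (ix := fun k => mi_add k.1 k.2)
  (wt := fun k : multi_index * multi_index => c1 k.1 * c2 k.2)) => // z Dz.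
  by apply: eq_usum (usum_mul (s1 _ Dz) (s2 _ Dz)) => k; rewrite E.
apply: abs_bounded_le (abs_bounded_mul (b1 _ Dz) (b2 _ Dz)) => k.
by rewrite E.
Qed.

Lemma has_seriesZ D (k : C) h c m : has_series D h c m ->
  has_series D (fun z => k * h z) (fun a => k * c a) (fun z => nc k * m z).
Proof.
move=> [hs hb]; split=> z Dz.
  by apply: eq_usum (usumZ k (hs _ Dz)) => a; rewrite mulrA.
apply: abs_bounded_le (abs_boundedZ k (hb _ Dz)) => a.
by rewrite mulrA.
Qed.

Lemma power_series_cst D (k : C) :
  power_series_on D (fun=> k) (fun a => if a == mi0 then k else 0).
Proof.
move=> z Dz; set u := fun a => _.
have := @usum_fin R multi_index [fset mi0]%fset u.
rewrite big_seq_fset1 (_ : u mi0 = k) ?/u ?eqxx ?monomial0 ?mulr1//; apply => a.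
by rewrite inE /u => /negPf ->; rewrite mul0r.
Qed.

Lemma has_series1 D :
  has_series D (fun=> 1) (fun a => if a == mi0 then 1 else 0) (fun=> 1).
Proof.
split=> [|z Dz A]; first exact: power_series_cst.
apply: (@le_trans _ _ (\sum_(a <- (A `|` [fset mi0])%fset)
    nc ((if a == mi0 then 1 else 0) * monomial a z))).
  by apply: ler_sum_fsubset => [|a]; rewrite ?fsubsetUl ?nc_ge0.
rewrite -(@big_fset_incl _ _ _ _ [fset mi0]%fset) ?fsubsetUr//.
  by rewrite big_seq_fset1 eqxx monomial0 mulr1 Normc.normc1.
by move=> a _; rewrite inE => /negPf ->; rewrite mul0r nc0.
Qed.

Lemma has_seriesX D h c m k : complete_Reinhardt D -> has_series D h c m ->
  exists ck, has_series D (fun z => h z ^+ k) ck (fun z => m z ^+ k).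
Proof.
move=> rD hD; elim: k => [|k [ck IH]].
  by eexists; exact: has_series1.
have [c' hc'] := has_series_mul rD hD IH; exists c'.
have -> : (fun z => h z ^+ k.+1) = (fun z => h z * h z ^+ k).
  by apply/funext => z; rewrite exprS.
by have -> : (fun z => m z ^+ k.+1) = (fun z => m z * m z ^+ k)
  by apply/funext => z; rewrite exprS.
Qed.

(** A series of power series: the double family is absolutely bounded, so it can
    be summed row by row, which gives [hh], or by exponents. *)
Lemma has_series_sum D (h : nat -> 'rV[C]_n -> C) c m hh mm :
  complete_Reinhardt D ->
  (forall k, has_series D (h k) (c k) (m k)) ->
  (forall z, D z -> unordered_sum (fun k => h k z) (hh z)) ->
  (forall z, D z -> forall A : {fset nat}, \sum_(k <- A) m k z <= mm z) ->
  exists cc, has_series D hh cc mm.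
Proof.
move=> rD hk hs hm.
pose w z (k : nat * multi_index) := c k.1 k.2 * monomial k.2 z.
have wb z : D z -> abs_bounded (w z) (mm z).
  move=> Dz; apply: abs_bounded_prod (hm z Dz) => k.
  exact: (hk k).2.
apply: (regroup_series (ix := fun k => k.2)
  (wt := fun k : nat * multi_index => c k.1 k.2)) => // z Dz.
have [s ws] := abs_bounded_usum (wb z Dz).
suff <- : s = hh z by [].
apply: usum_unique (hs z Dz); apply: (usum_iter (wb z Dz) ws) => k.
exact: (hk k).1.
Qed.

(** The quotient is [F] minus the terms [- (- s F)^k / (s k!)] with [k >= 2].
    Their bounds contain the factor [s^(k - 1) <= s], which is why the whole
    difference is of order [s]. *)
Lemma has_series_exp_tail D F c M (s : R) : complete_Reinhardt D ->
  has_series D F c M -> 0 < s -> s <= 1 ->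
  exists d, has_series D (fun z => (1 - cexp (- s%:C * F z)) / s%:C - F z) d
    (fun z => s * expR (M z)).
Proof.
move=> rD FM s0 s1.
have M0 z : D z -> 0 <= M z by move=> Dz; exact: abs_bounded_ge0 (FM.2 z Dz).
have sC0 : s%:C != 0 :> C.
  by rewrite -(rmorph0 (real_complex R)) (inj_eq (@complexI R)) gt_eqF.
pose q (k : nat) : C := if (k < 2)%N then 0 else - (s%:C^-1) * (- s%:C) ^+ k / k`!%:R.
have /choice[ck hck] k := has_seriesX k rD FM.
apply: (@has_series_sum D (fun k z => q k * F z ^+ k) (fun k a => q k * ck k a)
   (fun k z => nc (q k) * M z ^+ k)) => //.
- by move=> k; exact: has_seriesZ.
- move=> z Dz; have := usumZ (- (s%:C^-1)) (usum_exp_tail2 (- s%:C * F z)).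
  have -> : (- (s%:C^-1)) * (cexp (- s%:C * F z) - 1 - - s%:C * F z) =
     (1 - cexp (- s%:C * F z)) / s%:C - F z.
    by field.
  apply: eq_usum => k; rewrite /q; case: ifP => _; first by rewrite mul0r mulr0.
  by rewrite /exp_term exprMn !mulrA [LHS]mulrAC.
- move=> z Dz A.
  have := abs_boundedZ s%:C (abs_bounded_exp (M z)%:C) A.
  rewrite !ncR (gtr0_norm s0) (ger0_norm (M0 _ Dz)); apply: le_trans.
  apply: ler_sum => k _; rewrite ncM ncR (gtr0_norm s0) nc_exp_term ncR.
  rewrite (ger0_norm (M0 _ Dz)) /exp_coeff/= /q; case: ltnP => k2.
    by rewrite nc0 mul0r !mulr_ge0 ?exprn_ge0 ?M0 ?invr_ge0// ltW.
  rewrite !(ncM, ncN, ncV, ncX, ncR, nc_nat) (gtr0_norm s0).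
  rewrite [leLHS]mulrAC -[leLHS]mulrA ler_wpM2r//.
    by rewrite mulr_ge0 ?exprn_ge0 ?M0 ?invr_ge0.
  move: k2; case: k => [//|k]; rewrite ltnS => k1; rewrite exprS mulKf ?gt_eqF//.
  by rewrite -[leRHS]expr1 ler_wiXn2l ?(ltW s0).
Qed.

End PowerSeries.

(** * Convex domains in the plane *)

Section PlaneConvexity.
Variable R : realType.
Local Notation C := R[i].
Local Notation nc := (@Normc.normc R).
Implicit Types (G : set C) (a b p q w x y : C).

Lemma open_nc G x : open G -> G x ->
  exists2 e : R, 0 < e & forall y, nc (y - x) < e -> G y.
Proof.
move=> oG Gx.
have /nbhs_ballP[e /= e0 eG] : nbhs x G by exact: open_nbhs_nbhs.
have er : (complex.Re e)%:C = e by rewrite RRe_real// gtr0_real.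
exists (complex.Re e); first by rewrite -ltcR er.
move=> y xy; apply: eG; rewrite /ball/=.
by rewrite distrC normCE -er ltcR.
Qed.

Lemma convex_setC G : convex_set G -> forall x y (t : R), 0 <= t -> t <= 1 ->
  G x -> G y -> G (t%:C * x + (1 - t)%:C * y).
Proof.
move=> cG x y t t0 t1 Gx Gy.
have tC0 : 0 <= t%:C by rewrite lecR.
have tC1 : t%:C <= 1 by rewrite -(rmorph1 (real_complex R)) lecR.
have := cG x y (Itv01 tC0 tC1) (mem_set Gx) (mem_set Gy).
by rewrite inE rmorphB rmorph1.
Qed.

Lemma openboundary_notin G p : open G -> boundary G p -> ~ G p.
Proof. by rewrite /boundary => /interior_id -> []. Qed.

(** The last parameter on the segment from [a] to [x] for which the point is
    approached from inside [G]. *)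
Lemma boundary_on_segment G a x : open G -> G a -> ~ G x ->
  exists2 p, boundary G p & nc (p - a) <= nc (x - a).
Proof.
move=> oG Ga Gx; pose pt (t : R) := a + t%:C * (x - a).
pose E := [set t : R | (0 <= t <= 1) /\ G (pt t)].
have E0 : E 0 by split; rewrite ?lexx ?ler01// /pt mul0r addr0.
have E1 : ubound E 1 by move=> t [/andP[]].
have supE : has_sup E by split; [exists 0|exists 1].
pose t := sup E.
have t0 : 0 <= t by apply: ub_le_sup => //; exists 1.
have t1 : t <= 1 by apply: ge_sup => //; exists 0.
have ptB s s' : nc (pt s - pt s') = `|s - s'| * nc (x - a).
  by rewrite /pt opprD addrACA subrr add0r -mulrBl -rmorphB ncM ncR.
have xa0 : 0 < nc (x - a).
  rewrite lt_neqAle nc_ge0 andbT eq_sym nc_eq0 subr_eq0; apply/eqP => xa.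
  by rewrite xa in Gx.
exists (pt t); last first.
  rewrite -[a in leLHS](_ : pt 0 = a); last by rewrite /pt mul0r addr0.
  by rewrite ptB subr0 ger0_norm// ler_piMl ?nc_ge0.
rewrite /boundary (interior_id G).1//; split.
  move=> B /nbhs_ballP[e /= e0 eB].
  have er : (complex.Re e)%:C = e by rewrite RRe_real// gtr0_real.
  have e0' : 0 < complex.Re e by rewrite -ltcR er.
  have [s [/andP[s0 s1] Gs] ts] := sup_adherent (divr_gt0 e0' xa0) supE.
  exists (pt s); split=> //; apply: eB; rewrite /ball/= normCE -er ltcR ptB.
  have st : s <= t by apply: ub_le_sup; [exists 1|split => //; rewrite s0].
  by rewrite ger0_norm ?subr_ge0// -ltr_pdivlMr// ltrBlDr -ltrBlDl.
move=> Gt; have t1' : t < 1.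
  rewrite lt_neqAle t1 andbT; apply/eqP => t1'; apply: Gx.
  by move: Gt; rewrite t1' /pt mul1r addrC subrK.
have [e e0 eG] := open_nc oG Gt.
pose d := Num.min (1 - t) (e / nc (x - a) / 2).
have d0 : 0 < d by rewrite lt_min subr_gt0 t1' !divr_gt0.
suff : t + d <= t by rewrite gerDl leNgt d0.
apply: ub_le_sup; first by exists 1.
split; first by rewrite addr_ge0 ?(ltW d0)//= -lerBrDl ge_min lexx.
apply: eG; rewrite ptB addrC addKr gtr0_norm// -ltr_pdivlMr//.
by rewrite gt_min ltr_pdivrMr// ltr_pMr ?divr_gt0// ltr1n orbT.
Qed.

(** The largest disc of centre [a] contained in [G].  Its circle comes as close
    to the boundary as one likes; that it touches the boundary would need
    compactness, and is replaced by the tolerance [eta]. *)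
Lemma inscribed_disc G a : open G -> G a -> G <> setT ->
  exists rho : R, [/\ 0 < rho, (forall w, nc (w - a) < rho -> G w) &
    forall eta : R, 0 < eta ->
      exists2 p, boundary G p & rho <= nc (p - a) < rho + eta].
Proof.
move=> oG Ga GT; have [x0 Gx0] : exists x, ~ G x.
  by apply/existsNP => h; apply: GT; apply/seteqP; split.
pose E := [set t : R | forall w, nc (w - a) < t -> G w].
have [e e0 Ee] := open_nc oG Ga.
have Eub : has_ubound E.
  by exists (nc (x0 - a)) => t Et; rewrite leNgt; apply/negP => /Et.
have supE : has_sup E by split => //; exists e.
have h w : nc (w - a) < sup E -> G w.
  rewrite -subr_gt0 => d0; have [t Et] := sup_adherent d0 supE.
  by rewrite subKr => /Et.
exists (sup E); split=> [||eta eta0].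
- by rewrite (lt_le_trans e0)// ub_le_sup.
- exact: h.
- have [x Gx xa] : exists2 x, ~ G x & nc (x - a) < sup E + eta.
    apply: contrapT => hx; suff : sup E + eta <= sup E by rewrite gerDl leNgt eta0.
    apply: ub_le_sup => // w wa; apply: contrapT => Gw.
    by apply: hx; exists w.
  have [p bp pa] := boundary_on_segment oG Ga Gx.
  exists p => //; rewrite (le_lt_trans pa)// andbT leNgt; apply/negP => /h.
  exact: openboundary_notin.
Qed.

(** A line through 0 that misses the convex open set [H].  A segment joining
    points of [H] above and below the real axis crosses the axis on the positive
    side, as otherwise 0 would lie between the crossing point and 1.  Hence the
    numbers [- Re w / Im w] for [w] above the axis are less than those for [w]
    below it, and their supremum is a slope that separates them. *)
Lemma separating_slope (H : set C) :
  (forall x y (t : R), 0 <= t -> t <= 1 -> H x -> H y ->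
     H (t%:C * x + (1 - t)%:C * y)) ->
  (forall x, H x -> exists2 e : R, 0 < e & forall y, nc (y - x) < e -> H y) ->
  H 1 -> ~ H 0 ->
  exists m : R, forall w, H w -> 0 < complex.Re w + m * complex.Im w.
Proof.
move=> cH oH H1 H0.
have Hpos (x : R) : H x%:C -> 0 < x.
  move=> Hx; rewrite ltNge; apply/negP => x0; apply: H0.
  have x1 : 0 < 1 - x by lra.
  have -> : 0 = ((1 - x)^-1)%:C * x%:C + (1 - (1 - x)^-1)%:C * 1 :> C.
    rewrite mulr1 -rmorphM -rmorphD -(rmorph0 (real_complex R)); congr _%:C.
    by field; rewrite gt_eqF.
  apply: cH => //; first by rewrite invr_ge0 ltW.
  by rewrite invf_le1// lerDl oppr_ge0.
have [e e0 eH] := oH _ H1.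
have key (x1 y1 x2 y2 : R) : H (x1 +i* y1) -> H (x2 +i* y2) -> 0 < y1 -> y2 < 0 ->
    - x1 / y1 < x2 / - y2.
  move=> Hw1 Hw2 y10 y20; have d0 : 0 < y1 - y2 by lra.
  suff : 0 < - y2 * x1 + y1 * x2.
    rewrite ltr_pdivrMr// mulrAC ltr_pdivlMr ?oppr_gt0// => ?; lra.
  have : 0 < (- y2 * x1 + y1 * x2) / (y1 - y2).
    apply: Hpos.
    have -> : ((- y2 * x1 + y1 * x2) / (y1 - y2))%:C =
      (- y2 / (y1 - y2))%:C * (x1 +i* y1) + (1 - - y2 / (y1 - y2))%:C * (x2 +i* y2).
      apply/eqP; rewrite eq_complex /=; apply/andP; split; apply/eqP;
      by field; rewrite gt_eqF.
    apply: cH => //; first by rewrite divr_ge0// ltW// oppr_gt0.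
    by rewrite ler_pdivrMr// mul1r; lra.
  by rewrite pmulr_lgt0// invr_gt0.
have e2 : 0 < e / 2 by rewrite divr_gt0.
have e2e : e / 2 < e by rewrite ltr_pdivrMr// ltr_pMr// ltr1n.
have Hup : H (1 +i* (e / 2)).
  apply: eH; rewrite [_ - _](_ : _ = (0 +i* (e / 2))%C); last first.
    by apply/eqP; rewrite eq_complex /= subrr subr0 !eqxx.
  by rewrite /= expr0n add0r sqrtr_sqr gtr0_norm.
have Hdn : H (1 +i* (- (e / 2))).
  apply: eH; rewrite [_ - _](_ : _ = (0 +i* (- (e / 2)))%C); last first.
    by apply/eqP; rewrite eq_complex /= subrr subr0 !eqxx.
  by rewrite /= expr0n add0r sqrtr_sqr normrN gtr0_norm.
pose E := [set - complex.Re w / complex.Im w | w in [set w | H w /\ 0 < complex.Im w]].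
have E0 : E !=set0 by exists (- 1 / (e / 2)); exists (1 +i* (e / 2)).
have Eub : has_ubound E.
  exists (1 / - - (e / 2)) => _ [[x1 y1] [/= Hw y10] <-].
  by apply: ltW; apply: key Hdn _ _ => //; rewrite oppr_lt0.
exists (sup E).
have weak w : H w -> 0 <= complex.Re w + sup E * complex.Im w.
  case: w => x y Hw /=; case: (ltrgtP y 0) => [y0|y0|y0].
  - have : sup E <= x / - y.
      by apply: ge_sup => // _ [[x1 y1] [/= Hw1 y10] <-]; apply/ltW/key.
    by rewrite ler_pdivlMr ?oppr_gt0// => ?; lra.
  - have : - x / y <= sup E by apply: ub_le_sup => //; exists (x +i* y).
    by rewrite ler_pdivrMr// => ?; lra.
  - by move: Hw; rewrite y0 mulr0 addr0 => /Hpos/ltW.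
(* The inequality is strict because it still holds weakly after moving [w]
   slightly to the left. *)
move=> w Hw; have [d d0 dH] := oH _ Hw.
have d2 : d / 2 < d by rewrite ltr_pdivrMr// ltr_pMr// ltr1n.
have /weak : H (w - (d / 2)%:C).
  by apply: dH; rewrite addrAC subrr add0r ncN ncR gtr0_norm// divr_gt0.
case: w {Hw dH} => x y /=; rewrite oppr0 addr0.
have : 0 < d / 2 by rewrite divr_gt0.
by move=> ? ?; lra.
Qed.

(** [separating_slope] applies after the affine map sending [q] to 0 and a point
    [b] of [G] to 1. *)
Lemma supporting_halfplane G q : open G -> convex_set G -> G !=set0 -> ~ G q ->
  exists2 u : C, u != 0 & forall w, G w -> 0 < complex.Re (u * (w - q)).
Proof.
move=> oG /convex_setC cG [b Gb] Gq.
have bq0 : b - q != 0 by rewrite subr_eq0; apply/eqP => bq; rewrite bq in Gb.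
have nbq : 0 < nc (b - q) by rewrite lt_neqAle nc_ge0 andbT eq_sym nc_eq0.
pose H := [set w | G (q + (b - q) * w)].
have [||||m Hm] := @separating_slope H.
- move=> x y t t0 t1 Hx Hy; rewrite /H/=.
  have -> : q + (b - q) * (t%:C * x + (1 - t)%:C * y) =
    t%:C * (q + (b - q) * x) + (1 - t)%:C * (q + (b - q) * y).
    by rewrite rmorphB rmorph1; ring.
  exact: cG.
- move=> x Hx; have [e e0 eG] := open_nc oG Hx.
  exists (e / nc (b - q)); first exact: divr_gt0.
  move=> y; rewrite ltr_pdivlMr// mulrC -ncM => yx; apply: eG.
  by rewrite opprD addrACA subrr add0r -mulrBr.
- by rewrite /H/= mulr1 addrC subrK.
- by rewrite /H/= mulr0 addr0.
exists ((1 -i* m) / (b - q)).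
  rewrite mulf_neq0 ?invr_eq0// eq_complex /= negb_and oner_eq0//.
move=> w Gw; have := Hm ((w - q) / (b - q)).
rewrite /H/= mulrCA divff// mulr1 addrC subrK => /(_ Gw).
rewrite -mulrA [_^-1 * _]mulrC; case: (_ / _) => x y /=.
by rewrite mul1r mulNr opprK.
Qed.

Lemma convex_hull_id G : convex_set G -> convex_hull G = G.
Proof. exact: smallest_id. Qed.

End PlaneConvexity.

(** * Passing from one convex domain to another *)

Section Transfer.
Variables (R : realType) (n : nat).
Local Notation C := R[i].
Local Notation nc := (@Normc.normc R).
Local Notation multi_index := {ffun 'I_n -> nat}.
Local Notation mi0 := (mi0 n).
Implicit Types (D : set 'rV[C]_n) (G : set C) (A : {fset multi_index}).

(** The nonstrict Bohr inequality with the term of index [a] evaluated at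
    [zeta a].  Distances to the boundary are replaced by distances to each of
    its points [p], which is the form in which both the supporting half-planes
    and the inscribed disc are used. *)
Definition selector_bound D G (zeta : multi_index -> 'rV[C]_n) : Prop :=
  forall (f : 'rV[C]_n -> C) (c : multi_index -> C),
    holomorphic_on D f -> power_series_on D f c ->
    (forall z, D z -> G (f z)) ->
    forall p, boundary G p ->
    forall A, (forall a, a \in A -> (1 <= mi_deg a)%N) ->
      \sum_(a <- A) nc (c a * monomial a (zeta a)) <= nc (c mi0 - p).

Lemma power_series_bounded D f c : power_series_on D f c ->
  exists M, has_series D f c M.
Proof.
move=> fc; suff /choice[M hM] : forall z, exists m : R, D z ->
    abs_bounded (fun a => c a * monomial a z) m by exists M.
move=> z; have [Dz|nDz] := pselect (D z); last by exists 0.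
by have [m hm] := usum_abs_bounded (fc z Dz); exists m.
Qed.

Lemma holomorphic_exp_affine D f (a k u q : C) : holomorphic_on D f ->
  holomorphic_on D (fun z => a - k * cexp (u * (f z - q))).
Proof.
move=> hf z /hf dfz.
have -> : (fun z => a - k * cexp (u * (f z - q))) =
    cst a - k *: (cexp (R:=R) \o (u *: (f - cst q))) by [].
apply: differentiableB; first exact: differentiable_cst.
apply: differentiableZ; apply: differentiable_comp.
  by apply: differentiableZ; apply: differentiableB => //; exact: differentiable_cst.
exact: differentiable_cexp.
Qed.

(** The Bohr inequality of [G1] carries over to [g_s = F + d], where [d] stands
    for the coefficients of [g_s - F].  With [v] the direction from a near
    boundary point [p] to the centre [a0] of the inscribed disc of radius [rho],
    the similarity [w |-> (a0 - rho v) + rho s v w] sends [g_s] to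
    [a0 - rho v exp (- s F)], a function with values in that disc, and 0 to a
    point at distance less than [rho s e] from [p]. *)
Lemma regularized_bound D G1 zeta F cF M (s : R) :
  complete_Reinhardt D -> domain G1 -> G1 <> setT ->
  selector_bound D G1 zeta ->
  (forall a : C, forall k : C, holomorphic_on D (fun z => a - k * cexp (- s%:C * F z))) ->
  (forall z, D z -> 0 < complex.Re (F z)) ->
  has_series D F cF M -> 0 < s -> s <= 1 ->
  exists2 d, (forall z, D z -> abs_bounded (fun a => d a * monomial a z) (s * expR (M z)))
  & forall A, (forall a, a \in A -> (1 <= mi_deg a)%N) ->
    \sum_(a <- A) nc ((cF a + d a) * monomial a (zeta a)) <= nc (cF mi0 + d mi0).
Proof.
move=> rD [[a0 Ga0] oG _] GT bG1 hol Fpos sF s0 s1.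
have [d [sd bd]] := has_series_exp_tail rD sF s0 s1.
exists d => // A hA.
have [rho [rho0 inG near_bd]] := inscribed_disc oG Ga0 GT.
have rs0 : 0 < rho * s by rewrite mulr_gt0.
have sC0 : s%:C != 0 :> C.
  by rewrite -(rmorph0 (real_complex R)) (inj_eq (@complexI R)) gt_eqF.
apply/ler_addgt0Pl => e e0.
have [p bp /andP[pa_ge pa_lt]] := near_bd (rho * s * e) (mulr_gt0 rs0 e0).
have l0 : 0 < nc (p - a0) by rewrite (lt_le_trans rho0).
have lC0 : (nc (p - a0))%:C != 0 :> C.
  by rewrite -(rmorph0 (real_complex R)) (inj_eq (@complexI R)) gt_eqF.
have [v v1 ve] : exists2 v, nc v = 1 & a0 - p = (nc (p - a0))%:C * v.
  exists ((a0 - p) / (nc (p - a0))%:C); last by rewrite mulrC divfK.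
  by rewrite ncM ncV ncR ncB gtr0_norm// divff// gt_eqF.
have nk : nc (rho%:C * s%:C * v) = rho * s.
  by rewrite !ncM v1 !ncR !gtr0_norm// mulr1.
pose b a := (if a == mi0 then a0 - rho%:C * v else 0) + rho%:C * s%:C * v * (cF a + d a).
have psb : power_series_on D (fun z => a0 - rho%:C * v * cexp (- s%:C * F z)) b.
  move=> z Dz.
  have := usumD (power_series_cst (a0 - rho%:C * v) Dz)
    (usumZ (rho%:C * s%:C * v) (usumD (sF.1 z Dz) (sd z Dz))).
  have -> : a0 - rho%:C * v + rho%:C * s%:C * v *
      (F z + ((1 - cexp (- s%:C * F z)) / s%:C - F z)) =
      a0 - rho%:C * v * cexp (- s%:C * F z) by field.
  by apply: eq_usum => a; rewrite /b; case: ifP => _; ring.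
have /(_ _ p bp A hA) := bG1 _ _ (hol a0 (rho%:C * v)) psb.
have inG1 z : D z -> G1 (a0 - rho%:C * v * cexp (- s%:C * F z)).
  move=> Dz; apply: inG; rewrite addrAC subrr add0r ncN !ncM v1 ncR mulr1.
  rewrite gtr0_norm// gtr_pMr// nc_cexp expR_lt1.
  have := Fpos z Dz; case: (F z) => x y /= x0.
  by rewrite oppr0 mul0r subr0 mulNr oppr_lt0 mulr_gt0.
move=> /(_ inG1).
rewrite (eq_big_seq (fun a => rho * s * nc ((cF a + d a) * monomial a (zeta a)))); last first.
  move=> a /hA; rewrite lt0n mi_deg_eq0 => /negPf a0'.
  by rewrite /b a0' add0r -mulrA ncM nk.
rewrite -mulr_sumr => h; rewrite -(ler_pM2l rs0) (le_trans h)//.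
have -> : b mi0 - p = ((nc (p - a0))%:C - rho%:C) * v + rho%:C * s%:C * v * (cF mi0 + d mi0).
  by rewrite mulrBl -ve /b eqxx; ring.
rewrite (le_trans (ncD _ _))// [leRHS]mulrDr lerD//; last by rewrite ncM nk.
rewrite ncM v1 mulr1 -rmorphB ncR.
by rewrite ger0_norm ?subr_ge0// lerBlDl ltW.
Qed.

(** Let [s] tend to 0 in [regularized_bound]: only finitely many coefficients of
    [g_s - F] are involved and each is at most [s] times a constant. *)
Lemma selector_bound_transfer D G1 G2 zeta : complete_Reinhardt D ->
  domain G1 -> G1 <> setT -> domain G2 -> convex_set G2 ->
  selector_bound D G1 zeta -> selector_bound D G2 zeta.
Proof.
move=> rD dG1 G1T [G20 oG2 _] cG2 bG1 f c hf sf fG q bq A hA.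
have [u u0 Hu] := supporting_halfplane oG2 cG2 G20 (openboundary_notin oG2 bq).
have nu0 : 0 < nc u by rewrite lt_neqAle nc_ge0 andbT eq_sym nc_eq0.
pose F z := u * (f z - q).
pose cF a := u * (c a - if a == mi0 then q else 0).
have psF : power_series_on D F cF.
  move=> z Dz; have := usumZ u (usumB (sf z Dz) (power_series_cst q Dz)).
  by apply: eq_usum => a; rewrite /cF; ring.
have [M sF] := power_series_bounded psF.
have [z0 Dz0 z0j] := Reinhardt_coord_neq0 rD.
pose K a := expR (M z0) / nc (monomial a z0).
pose T := K mi0 + \sum_(a <- A) K a * nc (monomial a (zeta a)).
have K0 a : 0 <= K a by rewrite divr_ge0 ?expR_ge0 ?nc_ge0.
have T0 : 0 <= T by rewrite addr_ge0// sumr_ge0// => a _; rewrite mulr_ge0 ?nc_ge0.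
have main (s : R) : 0 < s -> s <= 1 ->
    \sum_(a <- A) nc (cF a * monomial a (zeta a)) <= nc (cF mi0) + s * T.
  move=> s0 s1.
  have [||d hd] := @regularized_bound D G1 zeta F cF M s rD dG1 G1T bG1 _ _ sF s0 s1.
  - move=> a k; rewrite /F.
    have -> : (fun z => a - k * cexp (- s%:C * (u * (f z - q)))) =
              (fun z => a - k * cexp (- s%:C * u * (f z - q))).
      by apply/funext => z; rewrite mulrA.
    exact: holomorphic_exp_affine.
  - by move=> z Dz; apply/Hu/fG.
  move=> /(_ A hA) h.
  have dK a : nc (d a) <= s * K a.
    have ma0 : 0 < nc (monomial a z0).
      by rewrite lt_neqAle nc_ge0 andbT eq_sym nc_eq0 monomial_neq0.
    rewrite mulrA ler_pdivlMr// -ncM.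
    by have := hd _ Dz0 [fset a]%fset; rewrite big_seq_fset1.
  apply: (@le_trans _ _ (\sum_(a <- A) (nc ((cF a + d a) * monomial a (zeta a)) +
      s * (K a * nc (monomial a (zeta a)))))).
    apply: ler_sum => a _.
    have -> : cF a * monomial a (zeta a) =
      (cF a + d a) * monomial a (zeta a) - d a * monomial a (zeta a) by ring.
    rewrite (le_trans (ncD _ _))// ncN lerD2l ncM mulrA ler_wpM2r ?nc_ge0//.
  rewrite big_split/= -mulr_sumr /T mulrDr addrA lerD2r (le_trans h)//.
  by rewrite (le_trans (ncD _ _))// lerD2l.
have lim : \sum_(a <- A) nc (cF a * monomial a (zeta a)) <= nc (cF mi0).
  apply/ler_addgt0Pr => e e0.
  pose s := Num.min 1 (e / (T + 1)).
  have T1 : 0 < T + 1 by rewrite ltr_wpDl.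
  have s0 : 0 < s by rewrite lt_min ltr01 divr_gt0.
  rewrite (le_trans (main s s0 _))// ?ge_min ?lexx// lerD2l.
  apply: (@le_trans _ _ (e / (T + 1) * T)).
    by rewrite ler_wpM2r// ge_min lexx orbT.
  by rewrite mulrAC ler_pdivrMr// ler_pM2l// lerDl.
rewrite -(ler_pM2l nu0) mulr_sumr -ncM.
move: lim; rewrite {2}/cF eqxx; apply: le_trans; rewrite le_eqVlt; apply/orP; left.
apply/eqP/eq_big_seq => a /hA; rewrite lt0n mi_deg_eq0 => /negPf a0.
by rewrite /cF a0 subr0 -[in RHS]mulrA [RHS]ncM.
Qed.

End Transfer.

(** * Comparison of the Bohr radii *)

Section BohrRadii.
Variables (R : realType) (n : nat).
Local Notation C := R[i].
Local Notation nc := (@Normc.normc R).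
Local Notation multi_index := {ffun 'I_n -> nat}.
Local Notation mi0 := (mi0 n).
Local Notation mi_pos := [set a : multi_index | (1 <= mi_deg a)%N].
Implicit Types (D : set 'rV[C]_n) (G : set C) (A : {fset multi_index}).

Lemma dist_boundary_real G (w : C) : open G -> G w -> G <> setT ->
  exists2 delta : R, 0 < delta & dist w (boundary G) = delta%:E.
Proof.
move=> oG Gw GT; have [e e0 eG] := open_nc oG Gw.
have [rho [_ _ near_bd]] := inscribed_disc oG Gw GT.
have [p bp _] := near_bd 1 ltr01.
have le_e : (e%:E <= dist w (boundary G))%E.
  apply: le_ereal_inf_tmp => _ [y by_ <-]; rewrite lee_fin leNgt ncB.
  by apply/negP => /eG; exact: openboundary_notin.
have le_p : (dist w (boundary G) <= (nc (w - p))%:E)%E.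
  by apply: ereal_inf_lbound; exists p.
move: le_e le_p; case: (dist _ _) => [d| |]//.
by rewrite lee_fin => ed _; exists d => //; exact: lt_le_trans ed.
Qed.

Lemma series_at0 D f c : complete_Reinhardt D -> power_series_on D f c ->
  f 0 = c mi0.
Proof.
move=> rD /(_ 0 (Reinhardt0 rD)) fc; apply: usum_unique fc _.
have := @usum_fin R multi_index [fset mi0]%fset
  (fun a => c a * monomial a (0 : 'rV[C]_n)).
rewrite big_seq_fset1 monomial0 mulr1; apply => a.
rewrite inE -mi_deg_eq0 -lt0n => a0.
by rewrite monomial_at0// mulr0.
Qed.

Lemma sum_le_esum A (g : multi_index -> \bar R) :
  (forall a, a \in A -> (1 <= mi_deg a)%N) ->
  (\sum_(a <- A) g a <= \esum_(a in mi_pos) g a)%E.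
Proof.
move=> hA; apply: esum_ge; exists [set` A].
  by split; [exact: finite_fset|move=> a /hA].
by rewrite fsbig_finite//= set_fsetK.
Qed.

Lemma esum_le_fset (g : multi_index -> \bar R) (y : \bar R) :
  (forall A, (forall a, a \in A -> (1 <= mi_deg a)%N) ->
    (\sum_(a <- A) g a <= y)%E) ->
  (\esum_(a in mi_pos) g a <= y)%E.
Proof.
move=> h; apply: ge_ereal_sup => _ [X [finX XP] <-].
rewrite fsbig_finite//; apply: h => a; rewrite in_fset_set// inE.
exact: XP.
Qed.

Lemma le_dist (x : R) (w : C) G :
  (forall p, boundary G p -> x <= nc (w - p)) ->
  (x%:E <= dist w (boundary G))%E.
Proof. by move=> h; apply: le_ereal_inf_tmp => _ [y hy <-]; rewrite lee_fin h. Qed.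

Lemma bohr1_selector D G r z : convex_set G -> bohr1_property D G r ->
  dilate r D z -> selector_bound D G (fun=> z).
Proof.
move=> cG bG rz f c hf sf fG p bp A hA.
rewrite -lee_fin -sumEFin; apply: (le_trans (sum_le_esum _ hA)).
apply: ltW; apply: (lt_le_trans (bG f c hf sf fG z rz)).
by apply: ereal_inf_lbound; rewrite convex_hull_id//; exists p.
Qed.

Lemma bohr2_selector D G r zeta : convex_set G -> bohr2_property D G r ->
  (forall a, dilate r D (zeta a)) -> selector_bound D G zeta.
Proof.
move=> cG bG rz f c hf sf fG p bp A hA.
rewrite -lee_fin -sumEFin.
apply: (@le_trans _ _ (\sum_(a <- A)
    ereal_sup [set (nc (c a * monomial a z))%:E | z in dilate r D])%E).
  by apply: lee_sum => a _; apply: ereal_sup_ubound; exists (zeta a).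
apply: (le_trans (sum_le_esum _ hA)).
apply: ltW; apply: (lt_le_trans (bG f c hf sf fG)).
by apply: ereal_inf_lbound; rewrite convex_hull_id//; exists p.
Qed.

Lemma dilateM D (r t : R) z : dilate (t * r) D z ->
  exists2 z', dilate r D z' & z = t%:C *: z'.
Proof.
by move=> [w Dw <-]; exists (r%:C *: w); [exists w|rewrite scalerA rmorphM].
Qed.

(** This gain of a factor [t] on the terms of positive degree is what turns the
    nonstrict inequality at [r] into the strict one at [t * r]. *)
Lemma dilate_term_le (t : R) (k : C) (a : multi_index) (z : 'rV[C]_n) : 0 <= t -> t <= 1 ->
  (1 <= mi_deg a)%N ->
  nc (k * monomial a (t%:C *: z)) <= t * nc (k * monomial a z).
Proof.
move=> t0 t1 a1; rewrite monomialZ mulrCA [leLHS]ncM ncX ncR ger0_norm//.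
by rewrite ler_wpM2r ?nc_ge0// -[leRHS]expr1 ler_wiXn2l.
Qed.

(** The points at which the suprema are nearly attained can be chosen for each
    index independently. *)
Lemma sum_ereal_sup (I : eqType) (T : Type) (Z : set T) (g : I -> T -> R)
    (s : seq I) (K : R) : uniq s -> Z !=set0 -> (forall i z, 0 <= g i z) ->
  (forall zeta : I -> T, (forall i, Z (zeta i)) ->
     \sum_(i <- s) g i (zeta i) <= K) ->
  (\sum_(i <- s) ereal_sup [set (g i z)%:E | z in Z] <= K%:E)%E.
Proof.
move=> us [z0 Zz0] g0; elim: s K us => [|i s IH] K.
  by move=> _ /(_ (fun=> z0) (fun=> Zz0)); rewrite !big_nil lee_fin.
rewrite cons_uniq => /andP[is_ us] h; rewrite big_cons.
set S := (\sum_(j <- s) _)%E.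
have hS z : Z z -> (S <= (K - g i z)%:E)%E.
  move=> Zz; apply: IH => // zeta hz.
  have := h (fun j => if j == i then z else zeta j).
  rewrite big_cons eqxx lerBrDl => h'.
  rewrite (eq_big_seq (fun j => g j (if j == i then z else zeta j))).
    by apply: h' => j; case: ifP.
  by move=> j js; case: eqP => // ji; rewrite -ji js in is_.
have S0 : (0 <= S)%E.
  apply: sume_ge0 => j _; apply: (@le_trans _ _ (g j z0)%:E).
    by rewrite lee_fin.
  by apply: ereal_sup_ubound; exists z0.
have Sfin : S \is a fin_num.
  by rewrite ge0_fin_numE// (le_lt_trans (hS z0 Zz0))// ltry.
rewrite -leeBrDr//; apply: ge_ereal_sup => _ [z Zz <-].
rewrite leeBrDr// -leeBrDl//.
by rewrite (le_trans (hS z Zz))// EFinB.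
Qed.

Lemma selector_bohr1 D G (r t : R) : complete_Reinhardt D ->
  open G -> convex_set G -> G <> setT ->
  (forall z, dilate r D z -> selector_bound D G (fun=> z)) ->
  0 <= t -> t < 1 -> bohr1_property D G (t * r).
Proof.
move=> rD oG cG GT h t0 t1 f c hf sf fG z /dilateM[z' rz' ->].
rewrite convex_hull_id//.
have Gc : G (c mi0) by rewrite -(series_at0 rD sf); exact: (fG _ (Reinhardt0 rD)).
have [delta d0 dE] := dist_boundary_real oG Gc GT; rewrite dE.
apply: (@le_lt_trans _ _ (t * delta)%:E); last by rewrite lte_fin gtr_pMl.
apply: esum_le_fset => A hA; rewrite sumEFin lee_fin.
apply: (@le_trans _ _ (t * \sum_(a <- A) nc (c a * monomial a z'))).
  rewrite mulr_sumr big_seq [leRHS]big_seq; apply: ler_sum => a /hA a1.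
  by apply: dilate_term_le => //; exact: ltW.
rewrite ler_wpM2l// -lee_fin -dE; apply: le_dist => p bp.
exact: (h z' rz' f c hf sf fG p bp A hA).
Qed.

Lemma selector_bohr2 D G (r t : R) : complete_Reinhardt D ->
  open G -> convex_set G -> G <> setT ->
  (forall zeta, (forall a, dilate r D (zeta a)) -> selector_bound D G zeta) ->
  0 <= t -> t < 1 -> bohr2_property D G (t * r).
Proof.
move=> rD oG cG GT h t0 t1 f c hf sf fG.
rewrite convex_hull_id//.
have Gc : G (c mi0) by rewrite -(series_at0 rD sf); exact: (fG _ (Reinhardt0 rD)).
have [delta d0 dE] := dist_boundary_real oG Gc GT; rewrite dE.
apply: (@le_lt_trans _ _ (t * delta)%:E); last by rewrite lte_fin gtr_pMl.
apply: esum_le_fset => A hA; apply: sum_ereal_sup => //.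
- by exists ((t * r)%:C *: 0), 0 => //; exact: Reinhardt0.
- by move=> *; exact: nc_ge0.
move=> zeta hz; have /choice[zeta' hz'] : forall a, exists z',
    dilate r D z' /\ zeta a = t%:C *: z'.
  by move=> a; have [z' ? ?] := dilateM (hz a); exists z'.
apply: (@le_trans _ _ (t * \sum_(a <- A) nc (c a * monomial a (zeta' a)))).
  rewrite mulr_sumr big_seq [leRHS]big_seq; apply: ler_sum => a /hA a1.
  by rewrite (hz' a).2; apply: dilate_term_le => //; exact: ltW.
rewrite ler_wpM2l// -lee_fin -dE; apply: le_dist => p bp.
by apply: (h zeta' _ f c hf sf fG p bp A hA) => a; exact: (hz' a).1.
Qed.

(** The factor [t = 0] puts 0 in the second set, so that its supremum is
    nonnegative even when [r = 0] is the only admissible value. *)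
Lemma sup_radius_le (P1 P2 : R -> Prop) :
  (forall r t : R, 0 <= r -> P1 r -> 0 <= t -> t < 1 -> P2 (t * r)) ->
  (ereal_sup [set r%:E | r in [set r : R | 0 <= r /\ P1 r]%R] <=
   ereal_sup [set r%:E | r in [set r : R | 0 <= r /\ P2 r]%R])%E.
Proof.
move=> h; apply: ge_ereal_sup => _ [r [r0 P1r] <-].
set S := ereal_sup _.
have hS (t : R) : 0 <= t -> t < 1 -> ((t * r)%:E <= S)%E.
  move=> t0 t1; apply: ereal_sup_ubound; exists (t * r) => //.
  by split; [rewrite mulr_ge0|exact: h].
have S0 : (0 <= S)%E by have := hS 0 (lexx _) ltr01; rewrite mul0r.
rewrite leNgt; apply/negP => Sr.
move: S0 Sr hS; case: S => [s| |]//; rewrite lee_fin lte_fin => s0 sr hS.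
have rp : 0 < r by exact: le_lt_trans sr.
have := hS ((s + r) / 2 / r).
rewrite divfK ?gt_eqF// lee_fin ltr_pdivrMr// mul1r.
rewrite !divr_ge0 ?addr_ge0// => /(_ isT).
have -> : (s + r) / 2 < r by lra.
by move=> /(_ isT); lra.
Qed.

Lemma R1_le D G1 G2 : complete_Reinhardt D ->
  domain G1 -> convex_set G1 -> G1 <> setT ->
  domain G2 -> convex_set G2 -> G2 <> setT -> (R1 D G1 <= R1 D G2)%E.
Proof.
move=> rD dG1 cG1 G1T dG2 cG2 G2T; apply: sup_radius_le => r t r0 b1 t0 t1.
have [_ oG2 _] := dG2; apply: selector_bohr1 => // z rz.
by apply: (selector_bound_transfer rD dG1) => //; exact: bohr1_selector b1 rz.
Qed.

Lemma R2_le D G1 G2 : complete_Reinhardt D ->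
  domain G1 -> convex_set G1 -> G1 <> setT ->
  domain G2 -> convex_set G2 -> G2 <> setT -> (R2 D G1 <= R2 D G2)%E.
Proof.
move=> rD dG1 cG1 G1T dG2 cG2 G2T; apply: sup_radius_le => r t r0 b1 t0 t1.
have [_ oG2 _] := dG2; apply: selector_bohr2 => // zeta rz.
by apply: (selector_bound_transfer rD dG1) => //; exact: bohr2_selector b1 rz.
Qed.

End BohrRadii.

Theorem corollary3p2 (R : realType) (n : nat) (hn : (1 <= n)%N)
    (G1 G2 : set R[i])
    (domG1 : domain G1) (convG1 : convex_set G1) (G1T : G1 <> setT)
    (domG2 : domain G2) (convG2 : convex_set G2) (G2T : G2 <> setT) :
  (forall D : set 'rV[R[i]]_n,
     complete_Reinhardt D -> R1 D G1 = R1 D G2) /\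
  (forall D : set 'rV[R[i]]_n,
     complete_Reinhardt D -> bounded_set D -> R2 D G1 = R2 D G2).
Proof.
split=> D rD; last move=> _.
- by apply/eqP; rewrite eq_le !R1_le.
- by apply/eqP; rewrite eq_le !R2_le.
Qed.
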